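(* Let $0<q<1$, let $a,b,c,d\in\mathbb C$ and let $0\le k\le n$ be integers. Then, as meromorphic functions of $z\in\mathbb C\setminus\{0\}$, with $x=\frac12(z+z^{-1})$, $$\varphi_k(x;a)\,\varphi_{n-k}(x;b)\,w(x;a,b,c,d)=w\bigl(x;aq^{k},bq^{n-k},c,d\bigr).$$
   Context: Notation: $(c;q)_k=\prod_{j=0}^{k-1}(1-cq^j)$, $(c;q)_\infty=\prod_{j\ge0}(1-cq^j)$, and $(c_1,\dots,c_r;q)_k=\prod_i(c_i;q)_k$ (also for $k=\infty$). The Askey–Wilson monomials are $\varphi_k(x;a)=(az,a/z;q)_k$ with $x=\frac12(z+z^{-1})$, $z=e^{i\theta}$. The Askey–Wilson weight is $$w(x;a,b,c,d)=\frac{(z^2,z^{-2};q)_\infty}{(az,a/z,bz,b/z,cz,c/z,dz,d/z;q)_\infty}.$$ *)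

(* Defs.v *)
From HB Require Import structures.
From mathcomp Require Import all_boot all_order all_algebra.
From mathcomp Require Import all_classical all_reals all_analysis.
From mathcomp Require Import complex.

Set Implicit Arguments.
Unset Strict Implicit.
Unset Printing Implicit Defensive.

Import Order.TTheory GRing.Theory Num.Theory numFieldNormedType.Exports.

Local Open Scope ring_scope.
Local Open Scope classical_set_scope.
Local Open Scope complex_scope.

(* The regular module R[i]^o carries the topology and the R[i]-normed module
   structure, so that [derivable f z 1] below is complex differentiability. *)
Notation Cplx R := (R[i]^o).

Definition qpoch (R : realType) (q c : Cplx R) (k : nat) : Cplx R :=
  \prod_(j < k) (1 - c * q ^+ j).

Definition qpoch_inf (R : realType) (q c : Cplx R) : Cplx R :=
  lim (qpoch q c k @[k --> \oo]).

Definition qpochs (R : realType) (q : Cplx R) (cs : seq (Cplx R)) (k : nat) :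
  Cplx R := \prod_(c <- cs) qpoch q c k.

Definition qpochs_inf (R : realType) (q : Cplx R) (cs : seq (Cplx R)) :
  Cplx R := \prod_(c <- cs) qpoch_inf q c.

(* The Askey-Wilson monomial and weight at x = (z + z^-1) / 2, as functions
   of z; both are invariant under z |-> z^-1. *)
Definition aw_monomial (R : realType) (q : Cplx R) (k : nat) (a z : Cplx R) :
  Cplx R := qpochs q [:: a * z; a / z] k.

Definition aw_weight (R : realType) (q a b c d z : Cplx R) : Cplx R :=
  qpochs_inf q [:: z ^+ 2; z ^- 2] /
  qpochs_inf q [:: a * z; a / z; b * z; b / z; c * z; c / z; d * z; d / z].

Definition holomorphic_near (R : realType) (f : Cplx R -> Cplx R)
  (p : Cplx R) : Prop := \forall z \near p, derivable f z 1.

Definition meromorphic_at (R : realType) (f : Cplx R -> Cplx R)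
    (p : Cplx R) : Prop :=
  exists g h : Cplx R -> Cplx R,
    [/\ holomorphic_near g p, holomorphic_near h p,
        \forall z \near p^', h z != 0 &
        \forall z \near p^', f z = g z / h z].

Definition meromorphic_on (R : realType) (U : set (Cplx R))
  (f : Cplx R -> Cplx R) : Prop := forall p, U p -> meromorphic_at f p.

(* Division is total, so the value of a function such as [aw_weight] at a pole
   is meaningless: equality of meromorphic functions on an open set U is
   equality off a closed discrete subset of U, i.e. on a punctured
   neighbourhood of every point of U. *)
Definition meromorphic_eq_on (R : realType) (U : set (Cplx R))
    (f g : Cplx R -> Cplx R) : Prop :=
  [/\ meromorphic_on U f, meromorphic_on U g &
      forall p, U p -> \forall z \near p^', f z = g z].

(* Main.v *)
Require Import Defs.
From HB Require Import structures.
From mathcomp Require Import all_boot all_order all_algebra.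
From mathcomp Require Import all_classical all_reals all_analysis.
From mathcomp Require Import complex ring.

Set Implicit Arguments.
Unset Strict Implicit.
Unset Printing Implicit Defensive.

Import Order.TTheory GRing.Theory Num.Theory numFieldNormedType.Exports.

Local Open Scope ring_scope.
Local Open Scope classical_set_scope.
Local Open Scope complex_scope.

(** The product [(c;q)_k] obeys a recurrence
    [u_(n+1) = u_n (1 - s q^n) + t_n q^n], whose solutions are bounded uniformly
    for bounded [s] and [t], hence Cauchy.  The divided differences
    [((c+h;q)_n - (c;q)_n) / h] obey a recurrence of the same kind, and are
    Lipschitz in [h] near [0], uniformly in [n]; passing to the limit, [(c;q)_oo]
    is entire in [c].  Since it is [1] at [c = 0], the relation
    [(c;q)_oo = (c;q)_k (c q^k;q)_oo] with [k] large shows that its zeros are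
    isolated.  So the weight is a quotient of holomorphic functions whose
    denominator vanishes on a discrete set only, and off that set the identity
    is this same relation applied at [a z], [a / z], [b z] and [b / z]. *)

(** * The real-valued modulus [normc] on [R[i]] *)

Import Normc.

Lemma normc_ge0 (R : rcfType) (x : R[i]) : 0 <= normc x.
Proof. by case: x => a b; exact: sqrtr_ge0. Qed.

Lemma normc_real (R : rcfType) (x : R) : normc x%:C = `|x|.
Proof. by rewrite /= expr0n addr0 sqrtr_sqr. Qed.

Lemma normcXr (R : rcfType) (x : R) n : 0 <= x -> normc (x%:C ^+ n) = x ^+ n.
Proof. by move=> x0; rewrite -rmorphXn normc_real ger0_norm ?exprn_ge0. Qed.

Lemma normc_Re_le (R : rcfType) (x : R[i]) : `|complex.Re x| <= normc x.
Proof.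
by case: x => a b /=; rewrite -sqrtr_sqr ler_wsqrtr// lerDl sqr_ge0.
Qed.

Lemma normc_Im_le (R : rcfType) (x : R[i]) : `|complex.Im x| <= normc x.
Proof.
by case: x => a b /=; rewrite -sqrtr_sqr ler_wsqrtr// lerDr sqr_ge0.
Qed.

Lemma normc_le_ReIm (R : rcfType) (x : R[i]) :
  normc x <= `|complex.Re x| + `|complex.Im x|.
Proof.
rewrite [in leLHS](complexE x) (le_trans (le_normcD _ _))// normcM !normc_real.
suff -> : normc 'i%C = 1 :> R by rewrite mul1r.
by rewrite /= expr0n add0r expr1n sqrtr1.
Qed.

(** * Limits of complex sequences through real estimates *)

Section ComplexLimits.
Context {R : realType}.
Implicit Types (T : Type) (l : Cplx R) (u : nat -> Cplx R).

(** Tolerances for limits in [Cplx R] live in [R[i]], but a positive element of [R[i]] has zero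
    imaginary part, so tolerances in [R] suffice. *)
Lemma cvg_normcP T (F : set_system T) (FF : Filter F) (f : T -> Cplx R) l :
  f @ F --> l <->
  (forall e : R, 0 < e -> \forall t \near F, normc (f t - l) <= e).
Proof.
split=> [/cvgrPdistC_le fl e e0|fl].
  have := fl e%:C; rewrite ltcR => /(_ e0); apply: filterS => t.
  by rewrite -lecR.
apply/cvgrPdistC_le => -[e e'] /=; rewrite ltcE /= => /andP[/eqP -> e0].
by apply: filterS (fl _ e0) => t; rewrite -lecR.
Qed.

Lemma normc_lim_le u l (b : R) :
  u @ \oo --> l -> (forall n, normc (u n) <= b) -> normc l <= b.
Proof.
move=> /cvg_normcP ul ub; apply/ler_addgt0Pr => e /ul [N _ /(_ N (leqnn _)) uN].
rewrite -(subrK (u N) l) (le_trans (le_normcD _ _))// addrC lerD//.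
by rewrite -normcN opprB.
Qed.

Lemma cvg_complex u (a b : R) :
  (fun n => complex.Re (u n)) @ \oo --> a ->
  (fun n => complex.Im (u n)) @ \oo --> b ->
  u @ \oo --> (a +i* b : Cplx R).
Proof.
move=> /cvgrPdistC_le ua /cvgrPdistC_le ub; apply/cvg_normcP => e e0.
have e20 : 0 < e / 2 by rewrite divr_gt0.
near=> n; apply: (le_trans (normc_le_ReIm _)); rewrite [leRHS]splitr lerD//.
  by case: (u n) (near (ua _ e20) n) => x y /= -> //; near: n.
by case: (u n) (near (ub _ e20) n) => x y /= -> //; near: n.
Unshelve. all: by end_near. Qed.

(** The telescoping series of [r] is dominated by a convergent geometric series. *)
Lemma cvgn_geometric_diffR (r : nat -> R) (q C : R) : 0 <= q -> q < 1 ->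
  (forall n, `|r n.+1 - r n| <= C * q ^+ n) -> cvgn r.
Proof.
move=> q0 q1 rC.
rewrite (_ : r = cst (r 0%N) + series (telescope r)); last first.
  by apply/funext => n; rewrite [LHS]eq_sum_telescope.
apply: is_cvgD; first exact: is_cvg_cst.
apply: normed_cvg; apply: (@series_le_cvg _ _ (geometric C q)) => //.
- by move=> n; exact: normr_ge0.
- by move=> n; rewrite (le_trans _ (rC n)).
- by apply: is_cvg_geometric_series; rewrite ger0_norm.
Qed.

(** The real case applies to the real and imaginary parts, since neither exceeds the modulus. *)
Lemma cvgn_geometric_diff u (q C : R) : 0 <= q -> q < 1 ->
  (forall n, normc (u n.+1 - u n) <= C * q ^+ n) -> cvgn u.
Proof.
move=> q0 q1 uC.
have /cvg_ex[a ua] : cvgn (fun n => complex.Re (u n)).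
  apply: (@cvgn_geometric_diffR _ q C) => // n.
  by rewrite (le_trans _ (uC n))// -raddfB normc_Re_le.
have /cvg_ex[b ub] : cvgn (fun n => complex.Im (u n)).
  apply: (@cvgn_geometric_diffR _ q C) => // n.
  by rewrite (le_trans _ (uC n))// -raddfB normc_Im_le.
by apply/cvg_ex; exists (a +i* b); exact: cvg_complex.
Qed.

End ComplexLimits.

(** * Complex differentiability and punctured neighbourhoods *)

Section Holomorphic.
Context {R : realType}.
Implicit Types (f g : Cplx R -> Cplx R) (z p : Cplx R).

Lemma holomorphicM f g z : derivable f z 1 -> derivable g z 1 ->
  derivable (fun x => f x * g x) z 1.
Proof. exact: derivableM. Qed.

Lemma holomorphicB f g z : derivable f z 1 -> derivable g z 1 ->
  derivable (fun x => f x - g x) z 1.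
Proof. exact: derivableB. Qed.

Lemma holomorphicV f z : f z != 0 -> derivable f z 1 ->
  derivable (fun x => (f x)^-1) z 1.
Proof. exact: derivableV. Qed.

Lemma holomorphic_comp f g z : derivable f z 1 -> derivable g (f z) 1 ->
  derivable (fun x => g (f x)) z 1.
Proof.
move=> /derivable1_diffP df /derivable1_diffP dg.
by apply/derivable1_diffP; exact: (differentiable_comp df dg).
Qed.

Lemma holomorphic_continuous f z : derivable f z 1 -> {for z, continuous f}.
Proof. by move=> /derivable1_diffP /differentiable_continuous. Qed.

Lemma near_neq0 p : p != 0 -> \forall z \near p, z != 0.
Proof. exact: (cvgr_neq0 _ (@cvg_id _ (nbhs p))). Qed.

(** Continuity keeps [f z] near [f p], and the second hypothesis keeps it different from [f p]. This
    transports isolation of zeros along [z |-> e * z] and [z |-> e / z]. *)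
Lemma near_punctured_comp f p (P : set (Cplx R)) : {for p, continuous f} ->
  (forall z, z != p -> f z != f p) ->
  (\forall w \near (f p)^', P w) -> \forall z \near p^', P (f z).
Proof.
move=> fc fp H; have {}H : \forall w \near f p, w != f p -> P w by [].
have {fc}H : \forall z \near p, f z != f p -> P (f z) by exact: fc H.
suff : \forall z \near p, z != p -> P (f z) by [].
by apply: filterS H => z Pz zp; exact/Pz/fp.
Qed.

Lemma holomorphic_scaler a z : derivable (fun x : Cplx R => x * a) z 1.
Proof.
by apply: holomorphicM; [exact: derivable_id|exact: derivable_cst].
Qed.

Lemma holomorphic_scale a z : derivable (fun x : Cplx R => a * x) z 1.
Proof.
by apply: holomorphicM; [exact: derivable_cst|exact: derivable_id].
Qed.

Lemma holomorphic_scaleV a z : z != 0 ->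
  derivable (fun x : Cplx R => a / x) z 1.
Proof.
move=> z0; apply: holomorphicM; first exact: derivable_cst.
by apply: holomorphicV => //; exact: derivable_id.
Qed.

(** This is the shape of the pair of factors that each parameter contributes to a monomial or to the
    denominator of the weight. *)
Lemma holomorphic_reflect f a z : (forall w, derivable f w 1) -> z != 0 ->
  derivable (fun x : Cplx R => f (a * x) * f (a / x)) z 1.
Proof.
move=> df z0; apply: holomorphicM.
  exact: (holomorphic_comp (@holomorphic_scale a z) (@df _)).
exact: (holomorphic_comp (@holomorphic_scaleV a _ z0) (@df _)).
Qed.

End Holomorphic.

(** * Recurrences with geometrically decaying coefficients, and the q-products they control *)

Section QPochhammer.
Context {R : realType} (q : R) (q_gt0 : 0 < q) (q_lt1 : q < 1).
Implicit Types A B : R.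

(* For [0 <= A], an upper bound for [\prod_(j < n) (1 + A * q ^+ j)], uniform
   in [n]. *)
Definition growth A := expR (A / (1 - q)).

(** Each step multiplies [x n + B] by at most [1 + A * q ^+ n <= expR (A * q ^+ n)], and these
    exponents sum to at most [A / (1 - q)]. *)
Lemma recurrence_leR (x : nat -> R) A B : 1 <= A -> 0 <= B -> 0 <= x 0%N ->
  (forall n, x n.+1 <= x n * (1 + A * q ^+ n) + B * q ^+ n) ->
  forall n, x n <= (x 0%N + B) * growth A.
Proof.
move=> A1 B0 x0 xS n; have A0 : 0 < A by exact: lt_le_trans A1.
have xn : x n + B <= (x 0%N + B) * expR (series (geometric A q) n).
  elim: n => [|n IHn]; first by rewrite /series /= big_geq// expR0 mulr1.
  rewrite seriesSr expRD mulrA.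
  have qn0 : 0 <= q ^+ n by rewrite exprn_ge0// ltW.
  have Aq : 0 <= 1 + A * q ^+ n by rewrite addr_ge0// mulr_ge0// ltW.
  (* Here [1 <= A] absorbs the source term: [B * q ^+ n <= B * (A * q ^+ n)]. *)
  apply: (@le_trans _ _ ((x n + B) * (1 + A * q ^+ n))).
    rewrite mulrDl (le_trans (lerD (xS n) (lexx B)))// -addrA lerD2l.
    rewrite mulrDr mulr1 [leRHS]addrC lerD2r ler_wpM2l//.
    by rewrite -[leLHS]mul1r ler_wpM2r.
  rewrite (le_trans (ler_wpM2r Aq IHn))// ler_wpM2l ?expR_ge1Dx//.
  by rewrite mulr_ge0 ?expR_ge0// addr_ge0.
apply: (@le_trans _ _ (x n + B)); first by rewrite lerDl.
apply: (le_trans xn); rewrite ler_wpM2l ?addr_ge0// ler_expR.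
by rewrite geometric_le_lim ?gtr0_norm// ltW.
Qed.

Lemma recurrence_le (u t : nat -> Cplx R) (s : Cplx R) A B :
  1 <= A -> normc s <= A -> (forall n, normc (t n) <= B) ->
  (forall n, u n.+1 = u n * (1 - s * q%:C ^+ n) + t n * q%:C ^+ n) ->
  forall n, normc (u n) <= (normc (u 0%N) + B) * growth A.
Proof.
move=> A1 sA tB uS; apply: recurrence_leR => //.
- exact: le_trans (normc_ge0 _) (tB 0%N).
- exact: normc_ge0.
move=> n; rewrite uS (le_trans (le_normcD _ _))// !normcM.
have qn0 : 0 <= q ^+ n by rewrite exprn_ge0// ltW.
rewrite !normcXr ?(ltW q_gt0)// lerD ?ler_wpM2r// ler_wpM2l ?normc_ge0//.
rewrite (le_trans (le_normcD _ _))// normc1 lerD2l normcN normcM.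
by rewrite normcXr ?(ltW q_gt0)// ler_wpM2r.
Qed.

(** Once [u] is known to be bounded, the recurrence makes its increments at most a constant times
    [q ^+ n]. *)
Lemma recurrence_cvg (u t : nat -> Cplx R) (s : Cplx R) B :
  (forall n, normc (t n) <= B) ->
  (forall n, u n.+1 = u n * (1 - s * q%:C ^+ n) + t n * q%:C ^+ n) ->
  cvgn u.
Proof.
move=> tB uS; pose A := 1 + normc s.
have A1 : 1 <= A by rewrite lerDl normc_ge0.
have sA : normc s <= A by rewrite lerDr.
have uB := recurrence_le A1 sA tB uS; set M := _ * _ in uB.
apply: (@cvgn_geometric_diff _ _ q (M * A + B)) => //; first exact: ltW.
move=> n; rewrite uS.
have -> : u n * (1 - s * q%:C ^+ n) + t n * q%:C ^+ n - u n =
  (t n - u n * s) * q%:C ^+ n by ring.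
rewrite normcM normcXr ?(ltW q_gt0)// ler_wpM2r ?exprn_ge0 ?(ltW q_gt0)//.
rewrite (le_trans (le_normcD _ _))// addrC lerD// normcN normcM.
by rewrite ler_pM ?normc_ge0.
Qed.

Lemma qpochS (Q c : Cplx R) n :
  qpoch Q c n.+1 = qpoch Q c n * (1 - c * Q ^+ n).
Proof. exact: big_ord_recr. Qed.

Lemma qpoch0 (Q c : Cplx R) : qpoch Q c 0 = 1.
Proof. exact: big_ord0. Qed.

Lemma qpochD (Q c : Cplx R) k n :
  qpoch Q c (k + n) = qpoch Q c k * qpoch Q (c * Q ^+ k) n.
Proof.
rewrite /qpoch big_split_ord /=; congr (_ * _).
by apply: eq_bigr => i _; rewrite exprD mulrA.
Qed.

Lemma qpoch_bounded (c : Cplx R) A n : 1 <= A -> normc c <= A ->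
  normc (qpoch q%:C c n) <= growth A.
Proof.
move=> A1 cA; have := @recurrence_le (qpoch q%:C c) (cst 0) c A 0 A1 cA _ _ n.
rewrite qpoch0 normc1 addr0 mul1r; apply=> [m|m].
  by rewrite normc0.
by rewrite qpochS mul0r addr0.
Qed.

Lemma cvg_qpoch (c : Cplx R) : qpoch q%:C c @ \oo --> qpoch_inf q%:C c.
Proof.
apply: (@recurrence_cvg _ (cst 0) c 0) => [m|m]; first by rewrite normc0.
by rewrite qpochS mul0r addr0.
Qed.

(** Let [n] tend to infinity in [qpochD]; shifting the index by [k] does not change the limit. *)
Lemma qpoch_infD (c : Cplx R) k :
  qpoch_inf q%:C c = qpoch q%:C c k * qpoch_inf q%:C (c * q%:C ^+ k).
Proof.
apply: (@cvg_lim _ (@norm_hausdorff _ _)).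
rewrite -(cvg_shiftn k).
rewrite (_ : [sequence _]_n =
    fun n => qpoch q%:C c k * qpoch q%:C (c * q%:C ^+ k) n); last first.
  by apply/funext => n; rewrite /= addnC qpochD.
by apply: cvgM; [exact: cvg_cst|exact: cvg_qpoch].
Qed.

Lemma qpoch_inf0 : qpoch_inf q%:C (0 : Cplx R) = 1.
Proof.
apply: (@lim_near_cst _ (@norm_hausdorff _ _)); near=> n.
by rewrite /qpoch big1// => i _; rewrite mul0r subr0.
Unshelve. all: by end_near.
Qed.

(* The difference quotient of [fun x => qpoch Q x n] between [c] and [c + h], in
   a form that makes sense at [h = 0]. *)
Fixpoint qpoch_slope (Q c h : Cplx R) n : Cplx R :=
  if n is m.+1 then
    qpoch_slope Q c h m * (1 - (c + h) * Q ^+ m) - qpoch Q c m * Q ^+ m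
  else 0.

Lemma qpoch_slopeE (Q c h : Cplx R) n :
  qpoch Q (c + h) n - qpoch Q c n = h * qpoch_slope Q c h n.
Proof.
elim: n => [|n IHn]; first by rewrite !qpoch0 subrr mulr0.
rewrite !qpochS /=.
have -> : qpoch Q (c + h) n = h * qpoch_slope Q c h n + qpoch Q c n.
  by rewrite -IHn subrK.
ring.
Qed.

Lemma cvg_qpoch_slope (c h : Cplx R) : cvgn (qpoch_slope q%:C c h).
Proof.
have A1 : 1 <= 1 + normc c by rewrite lerDl normc_ge0.
apply: (@recurrence_cvg _ (fun n => - qpoch q%:C c n) (c + h)) => n /=.
  rewrite normcN; by apply: (qpoch_bounded n A1); rewrite lerDr.
by rewrite mulNr.
Qed.

(** The difference of the slopes at [h] and at 0 starts at 0 and solves a recurrence of the same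
    kind, with source [- (h * qpoch_slope q%:C c 0 m)]. Its bound is therefore proportional to
    [normc h], uniformly in [n]. *)
Lemma qpoch_slope_lipschitz (c : Cplx R) : exists M : R, forall h n,
  normc h <= 1 ->
  normc (qpoch_slope q%:C c h n - qpoch_slope q%:C c 0 n) <= M * normc h.
Proof.
pose A := 1 + normc c.
have A1 : 1 <= A by rewrite lerDl normc_ge0.
have cA : normc c <= A by rewrite lerDr.
(* One factor bounds the source [- qpoch q%:C c n] of the slope recurrence; the other comes from
   [recurrence_le]. *)
pose D := growth A * growth A.
have slope0 n : normc (qpoch_slope q%:C c 0 n) <= D.
  have := @recurrence_le (qpoch_slope q%:C c 0) (fun n => - qpoch q%:C c n)
    c A (growth A) A1 cA.
  rewrite normc0 add0r; apply => m; last by rewrite /= addr0 mulNr.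
  by rewrite normcN qpoch_bounded.
exists (D * growth A) => h n h1.
have chA : normc (c + h) <= A.
  by rewrite (le_trans (le_normcD _ _))// addrC lerD.
pose e m := qpoch_slope q%:C c h m - qpoch_slope q%:C c 0 m.
pose t m := - (h * qpoch_slope q%:C c 0 m).
have tB m : normc (t m) <= normc h * D.
  by rewrite normcN normcM ler_wpM2l ?normc_ge0.
have eS m : e m.+1 = e m * (1 - (c + h) * q%:C ^+ m) + t m * q%:C ^+ m.
  by rewrite /e /t /=; ring.
have e0 : e 0%N = 0 by rewrite /e subrr.
have := recurrence_le A1 chA tB eS n.
by rewrite e0 normc0 add0r -(mulrA (normc h)) (mulrC (normc h)).
Qed.

(** For [h != 0] the limit [S h] of the slopes is the difference quotient. The uniform Lipschitz
    bound survives in the limit, so [S h] tends to [S 0], which is the derivative. *)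
Lemma derivable_qpoch_inf (c : Cplx R) : derivable (qpoch_inf q%:C) c 1.
Proof.
have [M HM] := qpoch_slope_lipschitz c.
pose S h : Cplx R := limn (qpoch_slope q%:C c h).
have SE h : qpoch_inf q%:C (c + h) - qpoch_inf q%:C c = h * S h.
  apply: (@cvg_unique _ (@norm_hausdorff _ _)
    ((fun n => qpoch q%:C (c + h) n - qpoch q%:C c n) @ \oo)).
    by apply: cvgB; exact: cvg_qpoch.
  rewrite (_ : (fun n => _) = fun n => h * qpoch_slope q%:C c h n); last first.
    by apply/funext => n; rewrite qpoch_slopeE.
  by apply: cvgM; [exact: cvg_cst|exact: cvg_qpoch_slope].
have SM h : normc h <= 1 -> normc (S h - S 0) <= M * normc h.
  move=> h1; apply: (@normc_lim_le _ (fun n =>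
    qpoch_slope q%:C c h n - qpoch_slope q%:C c 0 n)) => [|n]; last exact: HM.
  by apply: cvgB; exact: cvg_qpoch_slope.
apply/cvg_ex; exists (S 0); apply/cvg_normcP => e e0.
(* The sign of [M] is unknown, so [1 + |M|] serves as a positive Lipschitz constant. The minimum
   with 1 below stays in the range of [h] where the bound holds. *)
have K0 : 0 < 1 + `|M| by rewrite ltr_pwDl.
have d0 : 0 < Num.min 1 (e / (1 + `|M|)) by rewrite lt_min ltr01 divr_gt0.
have near0 : \forall h \near (0 : Cplx R),
    normc h <= Num.min 1 (e / (1 + `|M|)).
  have [d] := (cvg_normcP _ id 0).1 (@cvg_id _ (nbhs (0 : Cplx R))) _ d0.
  by move=> d1 H; exists d => // x /H; rewrite /= subr0.
apply: filterS2 (nbhs_dnbhs_neq _) (nbhs_dnbhs near0) => h h_neq0.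
rewrite le_min => /andP[h1 he].
rewrite /= /GRing.scale /= mulr1 (addrC h) SE mulKf//.
rewrite (le_trans (SM _ h1))//.
apply: (@le_trans _ _ ((1 + `|M|) * (e / (1 + `|M|)))); last first.
  by rewrite mulrC divfK// gt_eqF.
rewrite (le_trans (ler_wpM2r (normc_ge0 _) (ler_norm M)))//.
by rewrite ler_pM ?normc_ge0// lerDr.
Qed.

(** * Isolation of the zeros of the infinite product *)

Lemma cvg_expr_complex : (fun k => q%:C ^+ k : Cplx R) @ \oo --> (0 : Cplx R).
Proof.
apply/cvg_normcP => e e0.
have : (fun k => q ^+ k) @ \oo --> (0 : R).
  by apply: cvg_expr; rewrite gtr0_norm.
move=> /cvgrPdistC_le/(_ e e0); apply: filterS => k /=.
by rewrite !subr0 normcXr ?(ltW q_gt0)// ger0_norm ?exprn_ge0 ?(ltW q_gt0).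
Qed.

Lemma continuous_qpoch_inf : continuous (qpoch_inf q%:C : Cplx R -> Cplx R).
Proof.
by move=> c; exact/holomorphic_continuous/derivable_qpoch_inf.
Qed.

(** Each factor is affine in [x] with nonzero slope, hence vanishes for only one [x]. *)
Lemma qpoch_neq0_near (c : Cplx R) k : \forall x \near c^', qpoch q%:C x k != 0.
Proof.
elim: k => [|k IHk]; first by apply: nearW => x; rewrite qpoch0 oner_eq0.
suff factor_neq0 : \forall x \near c^', 1 - x * q%:C ^+ k != 0.
  by apply: filterS2 IHk factor_neq0 => x *; rewrite qpochS mulf_neq0.
have qk : q%:C ^+ k != 0 :> Cplx R.
  by rewrite expf_neq0// (inj_eq (@complexI _)) gt_eqF.
have [c0|c0] := eqVneq (1 - c * q%:C ^+ k) 0.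
  apply: filterS (nbhs_dnbhs_neq c) => x; apply: contra => /eqP x0.
  by apply/eqP; apply: (mulIf qk); apply: (can_inj (subKr 1)); rewrite x0 c0.
have fc : {for c, continuous (fun x : Cplx R => 1 - x * q%:C ^+ k)}.
  apply: holomorphic_continuous.
  by apply: holomorphicB; [exact: derivable_cst|exact: holomorphic_scaler].
exact/nbhs_dnbhs/(cvgr_neq0 _ fc c0).
Qed.

Lemma qpoch_inf_neq0_near (c : Cplx R) :
  \forall x \near c^', qpoch_inf q%:C x != 0.
Proof.
(* As [c * q%:C ^+ k] tends to 0, where the infinite product is 1, continuity supplies such a
   [k]. *)
have [k Hk] : exists k, qpoch_inf q%:C (c * q%:C ^+ k) != 0.
  have : (fun k => qpoch_inf q%:C (c * q%:C ^+ k)) @ \oo -->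
      qpoch_inf q%:C (0 : Cplx R).
    apply: (@cvg_comp _ _ _ (fun k => c * q%:C ^+ k) (qpoch_inf q%:C));
      last exact: continuous_qpoch_inf.
    rewrite -(mulr0 c); apply: cvgM; first exact: cvg_cst.
    exact: cvg_expr_complex.
  move=> /cvgr_neq0; rewrite qpoch_inf0 oner_eq0 => /(_ isT)[k _ Hk].
  by exists k; apply: Hk => /=.
have near_c : \forall x \near c, qpoch_inf q%:C (x * q%:C ^+ k) != 0.
  have fc : {for c,
      continuous (fun x : Cplx R => qpoch_inf q%:C (x * q%:C ^+ k))}.
    apply: holomorphic_continuous.
    exact/(holomorphic_comp (@holomorphic_scaler _ _ c))/derivable_qpoch_inf.
  exact: (cvgr_neq0 _ fc Hk).
apply: filterS2 (qpoch_neq0_near c k) (nbhs_dnbhs near_c) => x xk xoo.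
by rewrite (qpoch_infD x k) mulf_neq0.
Qed.

End QPochhammer.

(** * Holomorphy of the Askey-Wilson monomials *)

Section Monomial.
Context {R : realType}.
Implicit Types (Q a z : Cplx R).

Lemma holomorphic_qpoch Q z k :
  derivable (fun c => qpoch Q c k) z 1.
Proof.
elim: k => [|k IHk].
  rewrite (_ : (fun _ => _) = cst 1); first exact: derivable_cst.
  by apply/funext => c; exact: qpoch0.
rewrite (_ : (fun _ => _) = (fun c => qpoch Q c k * (1 - c * Q ^+ k))).
  apply: (holomorphicM (f := fun c => qpoch Q c k)) IHk _.
  by apply: holomorphicB; [exact: derivable_cst|exact: holomorphic_scaler].
by apply/funext => c; exact: qpochS.
Qed.

Lemma holomorphic_monomial Q a z k : z != 0 ->
  derivable (aw_monomial Q k a) z 1.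
Proof.
move=> z0.
rewrite (_ : aw_monomial Q k a =
    fun x => qpoch Q (a * x) k * qpoch Q (a / x) k); last first.
  by apply/funext => x; rewrite /aw_monomial /qpochs !big_cons big_nil mulr1.
apply: (holomorphic_reflect (f := fun x => qpoch Q x k)) z0 => w.
exact: holomorphic_qpoch.
Qed.

End Monomial.

(** * The weight as a quotient of holomorphic functions *)

Section Weight.
Context {R : realType} (q : R) (q_gt0 : 0 < q) (q_lt1 : q < 1).
Implicit Types a b c d z p : Cplx R.
Let Q : Cplx R := q%:C.

Definition aw_num z := qpochs_inf Q [:: z ^+ 2; z ^- 2].

Definition aw_den a b c d z :=
  qpochs_inf Q [:: a * z; a / z; b * z; b / z; c * z; c / z; d * z; d / z].

Lemma aw_denE a b c d z : aw_den a b c d z =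
  (qpoch_inf Q (a * z) * qpoch_inf Q (a / z)) *
  (qpoch_inf Q (b * z) * qpoch_inf Q (b / z)) *
  ((qpoch_inf Q (c * z) * qpoch_inf Q (c / z)) *
  (qpoch_inf Q (d * z) * qpoch_inf Q (d / z))).
Proof. by rewrite /aw_den /qpochs_inf !big_cons big_nil mulr1 !mulrA. Qed.

Lemma holomorphic_num z : z != 0 -> derivable aw_num z 1.
Proof.
move=> z0.
rewrite (_ : aw_num =
    fun x => qpoch_inf Q (x * x) * qpoch_inf Q (x * x)^-1); last first.
  by apply/funext => x; rewrite /aw_num /qpochs_inf !big_cons big_nil mulr1.
have dXX : derivable (fun x : Cplx R => x * x) z 1.
  by apply: holomorphicM; exact: derivable_id.
apply: holomorphicM; first exact/(holomorphic_comp dXX)/derivable_qpoch_inf.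
apply: (@holomorphic_comp _ (fun x => (x * x)^-1)).
  by apply: holomorphicV; rewrite ?mulf_neq0.
exact: derivable_qpoch_inf.
Qed.

Lemma holomorphic_den a b c d z : z != 0 -> derivable (aw_den a b c d) z 1.
Proof.
move=> z0; rewrite (funext (aw_denE a b c d)).
have dE e :
    derivable (fun x : Cplx R => qpoch_inf Q (e * x) * qpoch_inf Q (e / x)) z 1.
  apply: (holomorphic_reflect (f := qpoch_inf Q)) z0 => w.
  exact: derivable_qpoch_inf.
by apply: holomorphicM; apply: holomorphicM.
Qed.

Lemma aw_den_neq0_near a b c d p : p != 0 ->
  \forall z \near p^', aw_den a b c d z != 0.
Proof.
move=> p0.
have HE e : \forall z \near p^',
    qpoch_inf Q (e * z) * qpoch_inf Q (e / z) != 0.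
  (* For [e = 0] both [e * z] and [e / z] are constant, so [near_punctured_comp] does not apply; the
     product is then 1. *)
  have [->|e0] := eqVneq e 0.
    by apply: nearW => z; rewrite !mul0r qpoch_inf0 mulr1 oner_eq0.
  have H1 : \forall z \near p^', qpoch_inf Q (e * z) != 0.
    apply: (near_punctured_comp (f := fun z => e * z)
      (P := fun w => qpoch_inf Q w != 0)
      (holomorphic_continuous (@holomorphic_scale _ e p))).
      by move=> z; apply: contra => /eqP/(mulfI e0)->.
    exact: qpoch_inf_neq0_near.
  have H2 : \forall z \near p^', qpoch_inf Q (e / z) != 0.
    apply: (near_punctured_comp (f := fun z => e / z)
      (P := fun w => qpoch_inf Q w != 0)
      (holomorphic_continuous (@holomorphic_scaleV _ e _ p0))).
      (* The value [z = 0] is covered as well: the total inverse sends 0 to 0 and stays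
         injective. *)
      by move=> z; apply: contra => /eqP/(mulfI e0)/invr_inj->.
    exact: qpoch_inf_neq0_near.
  by apply: filterS2 H1 H2 => z h1 h2; rewrite mulf_neq0.
apply: filterS2 (filterI (HE a) (HE b)) (filterI (HE c) (HE d)).
move=> z [ha hb] [hc hd]; rewrite aw_denE.
exact: (mulf_neq0 (mulf_neq0 ha hb) (mulf_neq0 hc hd)).
Qed.

(** The first [k] or [m] factors are detached from the four products in [a] and [b]. Since the
    numerator of the weight is free of the parameters, this is the algebraic content of the
    theorem. *)
Lemma aw_den_shift a b c d z k m :
  aw_den a b c d z = aw_monomial Q k a z * aw_monomial Q m b z *
    aw_den (a * Q ^+ k) (b * Q ^+ m) c d z.
Proof.
rewrite !aw_denE /aw_monomial /qpochs !big_cons !big_nil !mulr1.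
rewrite (qpoch_infD q_gt0 q_lt1 (a * z) k) (qpoch_infD q_gt0 q_lt1 (a / z) k).
rewrite (qpoch_infD q_gt0 q_lt1 (b * z) m) (qpoch_infD q_gt0 q_lt1 (b / z) m).
rewrite -/Q (mulrAC a z) (mulrAC a z^-1) (mulrAC b z) (mulrAC b z^-1).
by ring.
Qed.

(** The prefactor [g] lets one statement serve both sides of the identity: a product of monomials on
    the left, the constant 1 on the right. *)
Lemma meromorphic_aw_weight (g : Cplx R -> Cplx R) a b c d :
  (forall z, z != 0 -> derivable g z 1) ->
  meromorphic_on [set z | z != 0] (fun z => g z * aw_weight Q a b c d z).
Proof.
move=> dg p /= p0; exists (fun z => g z * aw_num z), (aw_den a b c d); split.
- apply: filterS (near_neq0 p0) => z z0.
  by apply: holomorphicM; [exact: dg|exact: holomorphic_num].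
- by apply: filterS (near_neq0 p0) => z; exact: holomorphic_den.
- exact: aw_den_neq0_near.
- by apply: nearW => z; rewrite /aw_weight mulrA.
Qed.

End Weight.

Theorem lemma5p1 (R : realType) (q : R) (a b c d : Cplx R) (k n : nat)
  (hq0 : 0 < q) (hq1 : q < 1) (hkn : (k <= n)%N) :
  meromorphic_eq_on [set z : Cplx R | z != 0]
    (fun z => aw_monomial q%:C k a z * aw_monomial q%:C (n - k) b z
              * aw_weight q%:C a b c d z)
    (fun z => aw_weight q%:C (a * q%:C ^+ k) (b * q%:C ^+ (n - k)) c d z).
Proof.
split.
- apply: meromorphic_aw_weight => // z z0.
  by apply: holomorphicM; exact: holomorphic_monomial.
- have := @meromorphic_aw_weight _ _ hq0 hq1 (cst 1) (a * q%:C ^+ k)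
    (b * q%:C ^+ (n - k)) c d (fun z _ => derivable_cst _ _ _).
  by under [X in meromorphic_on _ X]funext => z do rewrite mul1r.
move=> p /= p0; apply: filterS (aw_den_neq0_near hq0 hq1 a b c d p0) => z.
rewrite (aw_den_shift hq0 hq1 a b c d z k (n - k)) => den0.
rewrite /aw_weight -/(aw_den q a b c d z) -/(aw_num q z).
rewrite (aw_den_shift hq0 hq1 a b c d z k (n - k)).
(* The monomials are factors of a nonzero denominator, so they cancel. At their zeros, by contrast,
   the left side would be 0. *)
have mon0 : aw_monomial q%:C k a z * aw_monomial q%:C (n - k) b z != 0.
  by apply: contraNneq den0 => ->; rewrite mul0r.
by rewrite mulrCA invfM mulVKf.
Qed.
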